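(* Let $R$ be a local admissible ring with $p\geq 2$ discrete valuation rings and conductor $\gamma$, and let $I\subseteq\mathrm{Frac}(R)$ be a fractional ideal with dual $I^\vee$. Let $\{g_1,\ldots,g_q\}$ be the set of irreducible absolute maximals of $R$ and $\{\beta_1,\ldots,\beta_s\}$ the set of irreducible absolute maximals of $I^\vee$. Let $\nu_{I^\vee}\in\mathbb{Z}^p$ be such that $\nu_{I^\vee}+\mathbb{N}^p\subseteq\mathrm{val}(I^\vee)$. Set, with $\underline{1}=(1,\ldots,1)$, $$F=\Big\{\sum_{j=1}^q\lambda_jg_j+\beta_i\ \Big|\ i\in\{1,\ldots,s\},\ \lambda_j\in\mathbb{N}\ \forall j,\ \sum_{j=1}^q\lambda_jg_j+\beta_i\leq\nu_{I^\vee}-\underline{1}\Big\},\qquad F'=\{\gamma-u-\underline{1}\mid u\in F\}.$$ Let $v\in\mathbb{Z}^p$ be such that for all $J\subseteq\{1,\ldots,p\}$ with $|J|=p-1$ we have $pr_J(v)\in pr_J(\mathrm{val}(I))$. Then $$v\in\mathrm{val}(I)\iff \forall w\in F',\ v\notin\Delta(w,\mathbb{Z}^p).$$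
   Context: **Admissible rings and values.** Let $(R,\mathfrak{m})$ be a one-dimensional Noetherian local Cohen-Macaulay ring, $\mathrm{Frac}(R)$ its total ring of fractions, $\widetilde{R}$ the integral closure of $R$ in $\mathrm{Frac}(R)$, and $\mathscr{V}$ the set of discrete valuation rings of $\mathrm{Frac}(R)$ over $R$. The ring $R$ is called admissible if (i) its completion $\widehat{R}$ is reduced; (ii) for every maximal ideal $\mathfrak{n}$ of $\widetilde{R}$, $\widetilde{R}/\mathfrak{n}=R/(\mathfrak{n}\cap R)$; (iii) $|R/\mathfrak{m}|\geq|\mathscr{V}|$. Put $p=|\mathscr{V}|$. Under (i), $\widetilde{R}$ is a finite product of semilocal principal ideal domains and $\mathrm{Frac}(R)$ is the product of their fraction fields; the elements of $\mathscr{V}$ correspond to the maximal ideals $\mathfrak{n}$ of $\widetilde{R}$, and the associated valuation of $x\in\mathrm{Frac}(R)$ is the $\mathfrak{n}$-adic valuation of the component of $x$ in the field factor to which $\mathfrak{n}$ belongs ($\infty$ if this component is $0$). Numbering these valuations $\mathrm{val}_1,\ldots,\mathrm{val}_p$ gives the value map $\mathrm{val}=(\mathrm{val}_1,\ldots,\mathrm{val}_p):\mathrm{Frac}(R)\to(\mathbb{Z}\cup\{\infty\})^p$. **Fractional ideals.** A fractional ideal is an $R$-submodule $I\subseteq\mathrm{Frac}(R)$ containing a non zero divisor of $\mathrm{Frac}(R)$ and such that $gI\subseteq R$ for some non zero divisor $g\in R$. Its set of values is $\mathrm{val}(I)=\{\mathrm{val}(g): g\in I \text{ a non zero divisor}\}\subset\mathbb{Z}^p$.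 In particular $\mathrm{val}(R)$ is defined (take $I=R$); it is a semigroup containing $0$. **Dual and conductor.** For $I,J\subseteq \mathrm{Frac}(R)$ put $(I:J)=\{a\in\mathrm{Frac}(R): aJ\subseteq I\}$. A canonical ideal is a fractional ideal $K$ such that $(K:(K:I))=I$ for all fractional ideals $I$. It is known that there is a canonical ideal $K^0$, unique up to multiplication by an invertible element of $\widetilde{R}$, with $R\subseteq K^0\subseteq\widetilde{R}$; fix one. The dual of $I$ is $I^\vee=(K^0:I)$. The conductor ideal is $\mathcal{C}_R=\widetilde{R}^\vee$, and the conductor of $R$ is the element $\gamma\in\mathbb{N}^p$ such that $\mathcal{C}_R=\{x\in\mathrm{Frac}(R):\mathrm{val}(x)\geq\gamma\}$ (so $\mathrm{val}(\mathcal{C}_R)=\gamma+\mathbb{N}^p$). **Notation.** $\mathbb{Z}^p$ carries the product order: $\alpha\leq\beta$ iff $\alpha_i\leq\beta_i$ for all $i$. For $J\subseteq\{1,\ldots,p\}$, $pr_J:\mathbb{Z}^p\to\mathbb{Z}^{|J|}$ is $pr_J(v_1,\ldots,v_p)=(v_j)_{j\in J}$. For $\alpha\in\mathbb{Z}^p$, $\mathcal{E}\subseteq\mathbb{Z}^p$, $J\subseteq\{1,\ldots,p\}$, let $\Delta_J(\alpha,\mathcal{E})=\{v\in\mathcal{E}: v_j=\alpha_j\ \forall j\in J,\ v_j>\alpha_j\ \forall j\notin J\}$, $\Delta_i(\alpha,\mathcal{E})=\Delta_{\{i\}}(\alpha,\mathcal{E})$, $\Delta(\alpha,\mathcal{E})=\bigcup_{i=1}^p\Delta_i(\alpha,\mathcal{E})$,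 and $\Delta_J(\alpha,I)=\Delta_J(\alpha,\mathrm{val}(I))$ for a fractional ideal $I$. **Irreducible absolute maximals.** $\alpha\in\mathrm{val}(I)$ is an absolute maximal of $I$ if $\Delta_J(\alpha,I)=\emptyset$ for all $J\subseteq\{1,\ldots,p\}$ with $J\neq\emptyset$ and $J\neq\{1,\ldots,p\}$. An absolute maximal $v$ of a fractional ideal $I$ is an irreducible absolute maximal of $I$ if it cannot be written $v=a+b$ with $a\in\mathrm{val}(R)\setminus\{0\}$ and $b\in\mathrm{val}(I)$. For the ring $R$ itself, an irreducible absolute maximal of $R$ means a nonzero absolute maximal of $R$ that cannot be written as $a+b$ with $a,b\in\mathrm{val}(R)\setminus\{0\}$. These sets are finite. *)

(* Defs.v *)
From mathcomp Require Import all_boot all_order all_algebra.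
From mathcomp Require Import boolp classical_sets functions cardinality.
From mathcomp Require Import constructive_ereal.

Set Implicit Arguments.
Unset Strict Implicit.
Unset Printing Implicit Defensive.

Import Order.TTheory GRing.Theory Num.Theory.

Local Open Scope classical_set_scope.
Local Open Scope ring_scope.

Section CommutativeAlgebra.
Variable A : comNzRingType.
Implicit Types (S I J P : set A) (s : seq A).

(* Ideals of a subring S of A; S = setT gives the ideals of A.  The unit ideal
   is allowed. *)
Definition ideal S I : Prop :=
  [/\ I `<=` S, I 0,
      (forall x y, I x -> I y -> I (x + y)) &
      (forall a x, S a -> I x -> I (a * x))].

Definition maximal_ideal S I : Prop :=
  [/\ ideal S I, I <> S &
      forall J, ideal S J -> I `<=` J -> J = I \/ J = S].

Definition prime_ideal P : Prop :=
  [/\ ideal setT P, ~ P 1 & forall x y, P (x * y) -> P x \/ P y].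

Definition ideal_gen (X : set A) : set A := smallest (ideal setT) X.

Definition ideal_mul I J : set A := ideal_gen [set x * y | x in I & y in J].

Fixpoint ideal_exp I (n : nat) : set A :=
  if n is n'.+1 then ideal_mul (ideal_exp I n') I else setT.

Definition noetherian : Prop :=
  forall I, ideal setT I -> exists s, I = ideal_gen [set` s].

Definition local_ring (m : set A) : Prop :=
  forall I, maximal_ideal setT I <-> I = m.

Definition prime_chain (d : nat) : Prop :=
  exists P : nat -> set A,
    (forall i, (i <= d)%N -> prime_ideal (P i)) /\
    (forall i, (i < d)%N -> P i `<` P i.+1).

Definition krull_dim (d : nat) : Prop := prime_chain d /\ ~ prime_chain d.+1.

Definition regular_sequence s : Prop :=
  (forall i, (i < size s)%N -> forall x,
     ideal_gen [set` take i s] (s`_i * x) -> ideal_gen [set` take i s] x) /\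
  ~ ideal_gen [set` s] 1.

Definition depth_ge (m : set A) (d : nat) : Prop :=
  exists s, [/\ size s = d, [set` s] `<=` m & regular_sequence s].

Definition depth (m : set A) (d : nat) : Prop :=
  depth_ge m d /\ ~ depth_ge m d.+1.

Definition cohen_macaulay (m : set A) : Prop :=
  exists d, krull_dim d /\ depth m d.

(* An element of the completion lim_n A/m^n is represented by a sequence x with
   x_{n+1} = x_n mod m^n; x and y represent the same element iff x - y is
   adic_null, and the ring operations are computed termwise. *)
Definition adic_coherent (m : set A) (x : nat -> A) : Prop :=
  forall n, ideal_exp m n (x n.+1 - x n).

Definition adic_null (m : set A) (x : nat -> A) : Prop :=
  forall n, ideal_exp m n (x n).

Definition completion_reduced (m : set A) : Prop :=
  forall x, adic_coherent m x ->
  forall k : nat, adic_null m (fun n => x n ^+ k) -> adic_null m x.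

Definition cosets I : set (set A) := range (fun x => [set y | I (y - x)]).

(* A discrete valuation of A is a map onto Z u {+oo}; the value +oo may be
   taken at nonzero elements.  If A is a finite product of fields, then v is
   +oo exactly at the elements with zero component in one of the factors, and
   v is a normalised discrete valuation of the component in that factor. *)
Definition discrete_valuation (v : A -> \bar int) : Prop :=
  [/\ range v = [set a | a != -oo%E],
      (forall x y, v (x * y) = (v x + v y)%E) &
      (forall x y, (Order.min (v x) (v y) <= v (x + y)%R)%E)].

Definition valuation_ring (v : A -> \bar int) : set A :=
  [set x | (0 <= v x)%E].

End CommutativeAlgebra.

Arguments noetherian A : clear implicits.
Arguments krull_dim A d : clear implicits.

Section FractionalIdeals.
Variables (R : comNzRingType) (Q : comUnitRingType) (iota : {rmorphism R -> Q}).
Implicit Types (I J K : set Q).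

(* GRing.lreg x says that x is a non zero divisor. *)
Definition total_ring_of_fractions : Prop :=
  [/\ injective iota,
      (forall s, GRing.lreg s -> iota s \is a GRing.unit) &
      (forall x, exists a s, GRing.lreg s /\ x = iota a / iota s)].

Definition int_closure : set Q := [set x | integralOver iota x].

Definition dvrs : set (set Q) :=
  [set V | range iota `<=` V /\
           exists v, discrete_valuation v /\ V = valuation_ring v].

Record admissible (m : set R) : Prop := Admissible {
  adm_noetherian : noetherian R;
  adm_local : local_ring m;
  adm_dim : krull_dim R 1;
  adm_cm : cohen_macaulay m;
  adm_reduced : completion_reduced m;
  adm_residue : forall n, maximal_ideal int_closure n ->
    forall x, int_closure x -> exists r, n (x - iota r);
  adm_card : (dvrs #<= cosets m)%card
}.

Definition fractional_ideal I : Prop :=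
  [/\ [/\ I 0, (forall x y, I x -> I y -> I (x + y)) &
               (forall r x, I x -> I (iota r * x))],
      (exists x, I x /\ GRing.lreg x) &
      (exists g, GRing.lreg g /\ forall x, I x -> range iota (iota g * x))].

Definition colon I J : set Q := [set a | forall y, J y -> I (a * y)].

Definition canonical_ideal K : Prop :=
  fractional_ideal K /\
  forall I, fractional_ideal I -> colon K (colon K I) = I.

Definition normalized_canonical_ideal K : Prop :=
  [/\ canonical_ideal K, range iota `<=` K & K `<=` int_closure].

Variable p : nat.
Variable val : 'I_p -> Q -> \bar int.

(* In particular p is the number of discrete valuation rings. *)
Definition value_map : Prop :=
  (forall i, discrete_valuation (val i)) /\
  set_bij [set: 'I_p] dvrs (fun i => valuation_ring (val i)).

Definition value_set I : set 'rV[int]_p :=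
  [set a | exists g, [/\ I g, GRing.lreg g &
                         forall i, val i g = (a ord0 i)%:E]].

(* K is the chosen canonical ideal. *)
Definition conductor K (gamma : 'rV[int]_p) : Prop :=
  (forall i, 0 <= gamma ord0 i) /\
  colon K int_closure =
    [set x | forall i, ((gamma ord0 i)%:E <= val i x)%E].

End FractionalIdeals.

Section Values.
Variable p : nat.
Implicit Types (a b w v : 'rV[int]_p) (E : set 'rV[int]_p) (J : {set 'I_p}).

Definition le_vec a b : Prop := forall i, a ord0 i <= b ord0 i.

Definition pr J v : 'rV[int]_#|J| := \row_(k < #|J|) v ord0 (enum_val k).

Definition DeltaJ J a E : set 'rV[int]_p :=
  [set v | [/\ E v, (forall j, j \in J -> v ord0 j = a ord0 j) &
                    (forall j, j \notin J -> a ord0 j < v ord0 j)]].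

Definition Delta a E : set 'rV[int]_p :=
  \bigcup_(i in [set: 'I_p]) DeltaJ (finset.set1 i) a E.

Definition absolute_maximal E a : Prop :=
  E a /\ forall J, J != finset.set0 -> J != finset.setTfor 'I_p ->
         DeltaJ J a E = set0.

(* ER and EI are the value sets of R and of a fractional ideal. *)
Definition irr_abs_max ER EI v : Prop :=
  absolute_maximal EI v /\
  ~ exists a b, [/\ ER a, a != 0, EI b & v = a + b].

Definition irr_abs_max_ring ER v : Prop :=
  [/\ v != 0, absolute_maximal ER v &
      ~ exists a b, [/\ ER a /\ a != 0, ER b /\ b != 0 & v = a + b]].

Definition setF q s (g : 'I_q -> 'rV[int]_p) (beta : 'I_s -> 'rV[int]_p)
    (nu : 'rV[int]_p) : set 'rV[int]_p :=
  [set u | exists (i : 'I_s) (lambda : 'I_q -> nat),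
     u = (\sum_(j < q) g j *+ lambda j) + beta i /\ le_vec u (nu - const_mx 1)].

Definition setF' (gamma : 'rV[int]_p) (F : set 'rV[int]_p) : set 'rV[int]_p :=
  [set gamma - u - const_mx 1 | u in F].

End Values.

(* Main.v *)
(* Write I' for the dual (K0 : I).  Products of elements of I and I' lie in K0,
   and no value of K0 lies in Delta(gamma - 1): an element of K0 with one value
   gamma_i - 1 and the others >= gamma_j would belong to the conductor, by
   equality of the residue fields.  Conversely, if v is not in val(I), then for
   some i no element of I with values >= v has i-th value v_i; dualizing twice
   gives an element of I' with value in Delta_i(gamma - v - 1).  The hypothesis
   on the projections of v bounds this set from above, and a maximal element of
   it is an absolute maximal of I', hence at most nu - 1 and a sum of
   irreducible ones.

   Since val(I') contains nu + N^p, every vector of Z^p is the value of a unit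
   of Frac(R).  With the conductor this shows that the integral closure is
   { val >= 0 } and that its ideals { val_i > 0 } are maximal. *)
Require Import Defs.
From mathcomp Require Import all_boot all_order all_algebra.
From mathcomp Require Import boolp classical_sets functions cardinality.
From mathcomp Require Import constructive_ereal zify ring.

Set Implicit Arguments.
Unset Strict Implicit.
Unset Printing Implicit Defensive.

Import Order.TTheory GRing.Theory Num.Theory.

Local Open Scope classical_set_scope.
Local Open Scope ring_scope.

(** * Discrete valuations with values in Z and +oo *)

Section DiscreteValuation.
Variables (A : comNzRingType) (v : A -> \bar int).
Hypothesis hv : discrete_valuation v.

Let dvalM x y : v (x * y) = (v x + v y)%E.
Proof. by case: hv. Qed.

Lemma dval_Nninfty x : v x != -oo%E.
Proof.
case: hv => hr _ _; have : range v (v x) by exists x.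
by rewrite hr.
Qed.

Lemma dval_surj a : a != -oo%E -> exists x, v x = a.
Proof.
case: hv => hr _ _ ha; have : range v a by rewrite hr.
by case=> x _ <-; exists x.
Qed.

Lemma dvalP x : v x = +oo%E \/ exists a : int, v x = a%:E.
Proof. by case: (v x) (dval_Nninfty x) => [a||] // _; [right; exists a | left]. Qed.

Lemma dval0 : v 0 = +oo%E.
Proof.
have [x vx] := @dval_surj +oo%E isT.
by rewrite -(mul0r x) dvalM vx addey // dval_Nninfty.
Qed.

Lemma dval1 : v 1 = 0%E.
Proof.
have [x vx] := @dval_surj 0%E isT.
by have := dvalM 1 x; rewrite mul1r vx adde0.
Qed.

Lemma dval_ge_add a x y :
  (a <= v x)%E -> (a <= v y)%E -> (a <= v (x + y)%R)%E.
Proof.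
case: hv => _ _ h ax ay; apply: le_trans (h x y).
by rewrite le_min ax.
Qed.

Lemma dval_gt_add a x y :
  (a < v x)%E -> (a < v y)%E -> (a < v (x + y)%R)%E.
Proof.
case: hv => _ _ h ax ay; apply: lt_le_trans (h x y).
by rewrite lt_min ax.
Qed.

Lemma dvalN x : v (- x) = v x.
Proof.
suff h : v (- 1) = 0%E by rewrite -mulN1r dvalM h add0e.
have : (v (- 1) + v (- 1) = 0)%E by rewrite -dvalM mulrNN mulr1 dval1.
by case: (v (- 1)) => // a [] h; congr (_%:E); lia.
Qed.

(** Otherwise [x = (x + y) - y] would be a sum of two elements of value greater than [v x]. *)
Lemma dvalD x y : (v x < v y)%E -> v (x + y) = v x.
Proof.
move=> xy; apply/eqP; rewrite eq_le; apply/andP; split; last first.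
  by apply: dval_ge_add => //; exact: ltW.
rewrite leNgt; apply/negP => h.
have : (v x < v (x + y - y)%R)%E by apply: dval_gt_add; rewrite ?dvalN.
by rewrite addrK ltxx.
Qed.

Lemma dval_ge_sum a (I : Type) (r : seq I) (P : pred I) (F : I -> A) :
  (forall i, P i -> (a <= v (F i))%E) -> (a <= v (\sum_(i <- r | P i) F i)%R)%E.
Proof.
move=> h; apply: (big_ind (fun x => a <= v x)%E) => //.
  by rewrite dval0 leey.
by move=> x y; exact: dval_ge_add.
Qed.

Lemma dvalX x a n : v x = a%:E -> v (x ^+ n) = (a *+ n)%:E.
Proof.
move=> vx; elim: n => [|n IHn]; first by rewrite expr0 dval1.
by rewrite exprS dvalM IHn vx mulrS.
Qed.

(** If [v x = a < 0], the leading term of a monic equation of degree n + 1 has value (n + 1)a, while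
    every other term has value at least na. *)
Lemma dval_integral (B : nzRingType) (f : {rmorphism B -> A}) x :
  (forall r, (0 <= v (f r))%E) -> integralOver f x -> (0 <= v x)%E.
Proof.
move=> hf [q qm]; have := monic_neq0 qm.
rewrite -size_poly_eq0; case E : (size q) => [//|n] _.
rewrite rootE horner_coef size_map_poly_id0; last first.
  by rewrite (monicP qm) rmorph1 oner_neq0.
rewrite E big_ord_recr /= !coef_map /=.
have -> : q`_n = 1 by move/monicP: qm; rewrite lead_coefE E.
rewrite rmorph1 mul1r addrC addr_eq0 => /eqP xn.
have [->|[a vx]] := dvalP x; first by rewrite leey.
rewrite vx leNgt; apply/negP; rewrite lte_fin => a0.
(* A monic equation of degree 0 would read [1 = 0]. *)
case: n E xn => [|n] E xn.
  by move: (congr1 v xn); rewrite expr0 big_ord0 oppr0 dval1 dval0.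
have : ((a *+ n)%:E <= v (x ^+ n.+1))%E.
  rewrite xn dvalN; apply: dval_ge_sum => i _.
  rewrite dvalM coef_map -[leLHS]add0e leeD //; first exact: hf.
  rewrite (dvalX _ vx) lee_fin ler_wnMn2l //; first exact: ltW.
  by rewrite -ltnS.
by rewrite (dvalX _ vx) lee_fin mulrS; lia.
Qed.

End DiscreteValuation.

Lemma dval_unit (A : comUnitRingType) (v : A -> \bar int) x :
  discrete_valuation v -> x \is a GRing.unit ->
  exists a : int, v x = a%:E /\ v (x^-1) = (- a)%:E.
Proof.
move=> hv ux; have : (v x + v (x^-1)%R = 0)%E.
  by case: (hv) => _ <- _; rewrite divrr // dval1.
have := dval_Nninfty hv x; case: (v x) => [a||] // _.
  by case: (v (x^-1)) => // b [] h; exists a; split => //; congr (_%:E); lia.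
by have := dval_Nninfty hv (x^-1); case: (v (x^-1)).
Qed.

(** * Noetherian rings and units of local rings *)

Section Ideals.
Variable A : comNzRingType.
Implicit Types (m : set A).

Let span (y : nat -> A) N := [set x | exists c : nat -> A, x = \sum_(k < N) c k * y k].

Lemma span_ideal y N : ideal setT (span y N).
Proof.
split=> //.
- by exists (fun=> 0); rewrite big1 // => k _; rewrite mul0r.
- move=> _ _ [c ->] [d ->]; exists (fun k => c k + d k).
  by rewrite -big_split /=; apply: eq_bigr => k _; rewrite mulrDl.
- move=> a _ _ [c ->]; exists (fun k => a * c k).
  by rewrite mulr_sumr; apply: eq_bigr => k _; rewrite mulrA.
Qed.

Lemma span_mono y N M : (N <= M)%N -> span y N `<=` span y M.
Proof.
move=> NM _ [c ->]; exists (fun k => if (k < N)%N then c k else 0).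
rewrite (big_ord_widen M (fun k => c k * y k)) // big_mkcond /=.
by apply: eq_bigr => k _; case: ifP => //; rewrite mul0r.
Qed.

(** The union of the increasing spans is finitely generated, hence equal to one of them, say the
    [N]-th, which then contains [y N]. This replaces Cayley-Hamilton arguments below. *)
Lemma noetherian_dependence (y : nat -> A) : noetherian A ->
  exists N (c : nat -> A), y N = \sum_(k < N) c k * y k.
Proof.
move=> noeth; pose S := \bigcup_N span y N.
have [s Ss] : exists s : seq A, S = ideal_gen [set` s].
  apply: noeth; split=> //.
  - by exists 0%N => //; case: (span_ideal y 0).
  - move=> a b [N _ aN] [M _ bM]; exists (maxn N M) => //.
    have [_ _ h _] := span_ideal y (maxn N M); apply: h.
      by apply: span_mono aN; exact: leq_maxl.
    by apply: span_mono bM; exact: leq_maxr.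
  - move=> a b _ [N _ bN]; exists N => //.
    by have [_ _ _ h] := span_ideal y N; apply: h.
have [N sN] : exists N, [set` s] `<=` span y N.
  have : [set` s] `<=` S by rewrite Ss; exact: sub_smallest.
  elim: s {Ss} => [|a s IHs] hs; first by exists 0%N.
  have [N hN] : exists N, [set` s] `<=` span y N.
    by apply: IHs => b bs; apply: hs; rewrite /= inE bs orbT.
  have [M _ aM] : S a by apply: hs; rewrite /= inE eqxx.
  exists (maxn N M) => b /=; rewrite inE => /orP[/eqP->|bs].
    by apply: span_mono aM; exact: leq_maxr.
  by apply: (span_mono (leq_maxl N M)); exact: hN.
have SN : S `<=` span y N.
  by rewrite Ss; apply: smallest_sub sN; exact: span_ideal.
have [c yN] : span y N (y N).
  apply: SN; exists N.+1 => //; exists (fun k => (k == N)%:R).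
  rewrite big_ord_recr /= eqxx mul1r big1 ?add0r // => k _.
  by rewrite (ltn_eqF (ltn_ord k)) mul0r.
by exists N, c.
Qed.

(** A non-unit [r] lies in a maximal ideal by Zorn's lemma, and the only one is [m]. *)
Lemma local_unit m r : local_ring m -> ~ m r -> exists b, b * r = 1.
Proof.
move=> hm mr; apply: contrapT => nr; apply: mr.
pose good X := [/\ ideal setT X, X r & ~ X 1].
have goodr : good [set x | exists b, x = b * r].
  split; last 1 first.
  - by case=> b rb; apply: nr; exists b.
  - split=> //; first by exists 0; rewrite mul0r.
      by move=> _ _ [b ->] [c ->]; exists (b + c); rewrite mulrDl.
    by move=> a _ _ [c ->]; exists (a * c); rewrite mulrA.
  - by exists 1; rewrite mul1r.
have [|X [PX maxX]] := @Zorn_bigcup A [set X | X = set0 \/ good X].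
  move=> F FP tot; have [[X FX gX]|nF] := pselect (exists2 X, F X & good X); last first.
    left; apply/seteqP; split=> // x [X FX Xx].
    by have [X0|gX] := FP _ FX; [rewrite X0 in Xx | case: nF; exists X].
  have gF Y y : F Y -> Y y -> good Y.
    by move=> FY Yy; have [Y0|] := FP _ FY => //; rewrite Y0 in Yy.
  right; split.
  - split=> //.
    + by exists X => //; case: gX => -[].
    + move=> a b [Y FY Ya] [Z FZ Zb].
      have [[[_ _ aY _] _ _] [[_ _ aZ _] _ _]] := (gF _ _ FY Ya, gF _ _ FZ Zb).
      have [YZ|ZY] := tot _ _ FY FZ.
        by exists Z => //; apply: aZ => //; exact: YZ.
      by exists Y => //; apply: aY => //; exact: ZY.
    + move=> a b _ [Y FY Yb]; exists Y => //.
      by have [[_ _ _ h] _ _] := gF _ _ FY Yb; apply: h.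
  - by exists X => //; case: gX.
  - by case=> Y FY Y1; have [_ _] := gF _ _ FY Y1.
have {PX}[iX Xr X1] : good X.
  case: PX => // X0; case: (maxX [set x | exists b, x = b * r]); last by right.
  by rewrite X0; split=> // h; case: (h r); exists 1; rewrite mul1r.
suff <- : X = m by [].
apply/hm; split=> //; first by move=> XT; apply: X1; rewrite XT.
move=> J iJ XJ; have [J1|J1] := pselect (J 1).
  right; apply/seteqP; split=> // x _; rewrite -(mulr1 x).
  by have [_ _ _ h] := iJ; apply: h.
left; apply/seteqP; split=> //; apply: contrapT => JX.
by apply: (maxX J) => //; right; split=> //; exact: XJ.
Qed.

End Ideals.

(** * Units of the total ring of fractions and colons of fractional ideals *)

Section TotalRingOfFractions.
Variables (R : comNzRingType) (Q : comUnitRingType) (iota : {rmorphism R -> Q}).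
Hypothesis hQ : total_ring_of_fractions iota.

Lemma unit_lreg (x : Q) : x \is a GRing.unit -> GRing.lreg x.
Proof. exact: mulrI. Qed.

(** For [x = a / s] a non zero divisor, the numerator [a] is a non zero divisor of [R], so its image
    is invertible. *)
Lemma lreg_unit (x : Q) : GRing.lreg x -> x \is a GRing.unit.
Proof.
case: hQ => inj reg frac; have [a [s [ls ->]]] := frac x.
have us := reg _ ls; move=> lx; rewrite unitrMl ?unitrV //; apply: reg.
move=> b c bc; apply: inj; apply: lx.
by rewrite mulrAC [RHS]mulrAC -!rmorphM bc.
Qed.

Definition submodule (I : set Q) : Prop :=
  [/\ I 0, forall x y, I x -> I y -> I (x + y) &
      forall r x, I x -> I (iota r * x)].

Lemma fractional_submodule I : fractional_ideal iota I -> submodule I.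
Proof. by case. Qed.

Lemma submodule_colon K I : submodule K -> submodule (colon K I).
Proof.
case=> K0 KD KM; split.
- by move=> y _; rewrite mul0r.
- by move=> x y hx hy z Iz; rewrite mulrDl; apply: KD; [exact: hx | exact: hy].
- by move=> r x hx z Iz; rewrite -mulrA; apply: KM; exact: hx.
Qed.

(** If [h I] lies in [R] and [k] is in [K], then [h k] is in the colon. If [g K] lies in [R] and
    [x = a / s] is a non zero divisor in [I], then [g a] is a common denominator. *)
Lemma fractional_colon K I :
  fractional_ideal iota K -> fractional_ideal iota I ->
  fractional_ideal iota (colon K I).
Proof.
move=> [sK [k [Kk lk]] [g [lg gK]]] [sI [x [Ix lx]] [h [lh hI]]].
case: hQ => inj reg frac; split; first exact: submodule_colon.
  exists (iota h * k); split; last first.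
    by apply: unit_lreg; rewrite unitrM reg //= lreg_unit.
  move=> y Iy; have [r _ rE] := hI y Iy.
  rewrite mulrAC -rE; have [_ _ KM] := sK; exact: KM.
have [a [s [ls xE]]] := frac x; exists (g * a); split.
  apply: (lregM lg) => b c bc; apply: inj; apply: lx.
  by rewrite xE mulrAC [RHS]mulrAC -!rmorphM bc.
move=> y hy; have [r _ rE] := gK _ (hy x Ix); exists (s * r) => //.
have aE : iota a = x * iota s by rewrite xE divrK // reg.
by rewrite rmorphM rE rmorphM aE; ring.
Qed.

End TotalRingOfFractions.

(** * Elementary properties of value sets *)

Section ValueSets.
Variables (R : comNzRingType) (Q : comUnitRingType) (iota : {rmorphism R -> Q}).
Hypothesis hQ : total_ring_of_fractions iota.
Variables (p : nat) (val : 'I_p -> Q -> \bar int).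
Hypothesis hval : value_map iota val.

Let dv i : discrete_valuation (val i). Proof. by case: hval. Qed.

Let valM i x y : val i (x * y) = (val i x + val i y)%E.
Proof. by case: (dv i). Qed.

Lemma val_iota i r : (0 <= val i (iota r))%E.
Proof.
have [_ [h _ _]] := hval.
have [hr _] : dvrs iota (valuation_ring (val i)) by apply: h.
by apply: hr; exists r.
Qed.

Lemma value_setD (X Y Z : set Q) a b :
  (forall x y, X x -> Y y -> Z (x * y)) ->
  value_set val X a -> value_set val Y b -> value_set val Z (a + b).
Proof.
move=> XYZ [x [Xx lx vx]] [y [Yy ly vy]]; exists (x * y); split.
- exact: XYZ.
- exact: lregM.
- by move=> i; rewrite valM vx vy mxE.
Qed.

Lemma value_set_lower_bound I : fractional_ideal iota I ->
  exists L, forall b, value_set val I b -> le_vec L b.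
Proof.
case=> _ _ [g [lg gI]]; have [_ reg _] := hQ.
exists (\row_i - fine (val i (iota g))) => b [x [Ix _ vx]] i; rewrite mxE.
have [a [va _]] := dval_unit (dv i) (reg _ lg).
have [r _ rE] := gI x Ix; have := val_iota i r.
by rewrite rE valM va vx -EFinD lee_fin /=; lia.
Qed.

(** The required element is a quotient of two elements of [E] with values [a + t] and [t], where [t]
    is large enough to put both above [nu]. *)
Lemma approx_of_cofinal (E : set Q) (nu : 'rV[int]_p) :
  (forall a, le_vec nu a -> value_set val E a) ->
  forall a : 'rV[int]_p, exists x, x \is a GRing.unit /\
    forall i, val i x = (a ord0 i)%:E.
Proof.
move=> hnu a; pose t i := `|a ord0 i| + `|nu ord0 i|.
have [|x [_ lx vx]] := hnu (\row_i (a ord0 i + t i)).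
  by move=> i; rewrite mxE /t; lia.
have [|y [_ ly vy]] := hnu (\row_i t i); first by move=> i; rewrite mxE /t; lia.
have [ux uy] := (lreg_unit hQ lx, lreg_unit hQ ly).
exists (x / y); split=> [|i]; first by rewrite unitrMl ?unitrV.
have [b [vyb vyV]] := dval_unit (dv i) uy.
move: vyb; rewrite valM vyV vx vy !mxE => -[<-].
by rewrite -EFinD addrK.
Qed.

End ValueSets.

(** * The value map: integral closure, residue fields and conductor *)

Section ValueMap.
Variables (R : comNzRingType) (Q : comUnitRingType) (iota : {rmorphism R -> Q}).
Variable m : set R.
Hypotheses (hQ : total_ring_of_fractions iota) (hR : admissible iota m).
Variables (p : nat) (val : 'I_p -> Q -> \bar int).
Hypothesis hval : value_map iota val.
Variables (K0 : set Q) (gamma : 'rV[int]_p).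
Hypothesis hK0 : normalized_canonical_ideal iota K0.
Hypothesis hgamma : conductor iota val K0 gamma.
Hypothesis p_gt0 : (0 < p)%N.
Hypothesis approx : forall a : 'rV[int]_p, exists x, x \is a GRing.unit /\
  forall i, val i x = (a ord0 i)%:E.
Implicit Types (i j l : 'I_p) (a b : 'rV[int]_p) (x y : Q).

(** Infinite values are allowed, which makes this a submodule; [valge gamma] is the conductor
    ideal. *)
Definition valge a : set Q := [set x | forall i, ((a ord0 i)%:E <= val i x)%E].

Let dv i : discrete_valuation (val i). Proof. by case: hval. Qed.

Let valM i x y : val i (x * y) = (val i x + val i y)%E.
Proof. by case: (dv i). Qed.

Let approxf (f : 'I_p -> int) : exists x, x \is a GRing.unit /\
  forall i, val i x = (f i)%:E.
Proof.
have [x [ux vx]] := approx (\row_i f i); exists x; split=> // i.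
by rewrite vx mxE.
Qed.

Let val_iota := val_iota hval.

Lemma valge_submodule a : submodule iota (valge a).
Proof.
split.
- by move=> i; rewrite (dval0 (dv i)) leey.
- by move=> x y hx hy i; apply: (dval_ge_add (dv i)).
- by move=> r x hx i; rewrite valM -[leLHS]add0e leeD.
Qed.

Lemma int_closure_val_ge0 x i : int_closure iota x -> (0 <= val i x)%E.
Proof. apply: dval_integral => //; exact: val_iota. Qed.

Lemma valge_gamma_sub x : valge gamma x -> K0 x.
Proof.
move=> hx; case: hgamma => _ E.
have : colon K0 (int_closure iota) x by rewrite E.
move=> /(_ 1); rewrite mulr1; apply; exact: integral1.
Qed.

Let submodK0 : submodule iota K0.
Proof. by case: hK0 => -[/fractional_submodule]. Qed.

Lemma local_proper : ideal setT m /\ ~ m 1.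
Proof.
have [im mT _] := (adm_local hR m).2 erefl; split=> // m1; apply: mT.
by apply/seteqP; split=> // x _; rewrite -(mulr1 x); case: im => _ _ _; apply.
Qed.

(** Outside [m] an element is invertible in [R], and both it and its inverse have values at least
    0. *)
Lemma val_gt0_local i r : (0 < val i (iota r))%E -> m r.
Proof.
move=> vr; apply: contrapT => /(local_unit (adm_local hR)) [b br].
have := valM i (iota b) (iota r); rewrite -rmorphM br rmorph1 (dval1 (dv i)) => E.
have : (0 < val i (iota b) + val i (iota r))%E.
  by apply: lte_paddl => //; exact: val_iota.
by rewrite -E ltxx.
Qed.

(** The denominator of any element of value -1 has positive value. *)
Lemma lreg_in_local : exists s, GRing.lreg s /\ m s.
Proof.
pose i := Ordinal p_gt0.
have [x vx] := @dval_surj _ _ (dv i) (- 1)%:E isT.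
case: hQ => _ reg /(_ x)[a [s [ls xE]]]; exists s; split=> //.
apply: (@val_gt0_local i).
have aE : iota a = x * iota s by rewrite xE divrK // reg.
have [b [vs _]] := dval_unit (dv i) (reg _ ls).
have := val_iota i a; rewrite aE valM vx vs -EFinD !lee_fin lte_fin; lia.
Qed.

(* The ideal yQ lies in the conductor, hence in R; in particular R contains all
   y / s^n, and the chain of ideals they generate stabilizes. *)
Lemma val_pinfty_eq0 y : (forall i, val i y = +oo%E) -> y = 0.
Proof.
move=> vy; have [s [ls ms]] := lreg_in_local.
case: hQ => inj reg _; have us := reg _ ls.
case: hK0 => -[[_ _ [g [lg gK]]] _] _ _; have ug := reg _ lg.
have [z zE] : {z : nat -> R & forall n, iota (z n) = y / iota s ^+ n}.
  apply: (@choice _ _ (fun n r => iota r = y / iota s ^+ n)) => n.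
  have [|r _ rE] := gK (y / (iota g * iota s ^+ n)).
    apply: valge_gamma_sub => i; rewrite valM vy.
    by rewrite addye ?leey // dval_Nninfty.
  by exists r; rewrite rE invrM ?unitrX // -[RHS](mulKr ug); ring.
have [N [c zN]] := noetherian_dependence z (adm_noetherian hR).
(* Multiplying the relation for [z N] by [s ^+ N] gives [y = r s y]; the exponent is lowered by one
   to split off a factor [s] of [m], so that [1 - r s] is a unit. *)
pose r := \sum_(k < N) c k * s ^+ (N - k).-1.
have yr : y * iota (1 - r * s) = 0.
  rewrite rmorphB rmorph1 mulrBr mulr1; apply/eqP; rewrite subr_eq0; apply/eqP.
  have yN : y = iota (z N) * iota s ^+ N by rewrite zE divrK // unitrX.
  rewrite [LHS]yN zN rmorph_sum /r mulr_suml mulr_suml rmorph_sum mulr_sumr.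
  apply: eq_bigr => k _; have kN := ltn_ord k.
  have -> : iota s ^+ N = iota s ^+ k * (iota s ^+ (N - k).-1 * iota s).
    by rewrite -exprSr prednK ?subn_gt0 // -exprD subnKC // ltnW.
  have yE : y = iota (z k) * iota s ^+ k by rewrite zE divrK // unitrX.
  by rewrite !rmorphM rmorphXn [X in _ = X * _]yE; ring.
have [[_ _ mD mM] m1] := local_proper.
have [|b br] := local_unit (adm_local hR) (r := 1 - r * s).
  by move=> h; apply: m1; rewrite -(subrK (r * s) 1); apply: mD => //; apply: mM.
by rewrite -(mulr1 y) -(rmorph1 iota) -br rmorphM mulrCA yr mulr0.
Qed.

(** If [x] is finite everywhere and [x (y - z) = 0], then [y - z] has all values infinite and
    vanishes. *)
Lemma val_fin_unit x : (forall i, val i x != +oo%E) -> x \is a GRing.unit.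
Proof.
move=> vx; apply: (lreg_unit hQ) => y z xyz; apply/eqP; rewrite -subr_eq0; apply/eqP.
apply: val_pinfty_eq0 => i.
have : (val i x + val i (y - z)%R = +oo)%E.
  by rewrite -valM mulrBr xyz subrr (dval0 (dv i)).
have [/eqP|[a ->]] := dvalP (dv i) x; first by rewrite (negbTE (vx i)).
by case: (val i (y - z)).
Qed.

Lemma val_unit x (f : 'I_p -> int) :
  (forall i, val i x = (f i)%:E) -> x \is a GRing.unit.
Proof. by move=> vx; apply: val_fin_unit => i; rewrite vx. Qed.

Lemma valV x i (a : int) : x \is a GRing.unit ->
  val i x = a%:E -> val i x^-1 = (- a)%:E.
Proof. by move=> ux vx; have [b [+ ->]] := dval_unit (dv i) ux; rewrite vx => -[->]. Qed.

(* If all val_i x >= 0, then all g c x^n lie in R, where val c = gamma and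
   g K0 is contained in R; this makes x integral. *)
Lemma int_closureE : int_closure iota = [set x | forall i, (0 <= val i x)%E].
Proof.
apply/seteqP; split=> x; first by move=> hx i; exact: int_closure_val_ge0.
move=> vx; have [c [uc vc]] := approx gamma.
case: hQ => inj reg _; case: hK0 => -[[_ _ [g [lg gK]]] _] _ _; have ug := reg _ lg.
have vX n i : (0 <= val i (x ^+ n))%E.
  elim: n => [|n IHn]; first by rewrite expr0 (dval1 (dv i)).
  by rewrite exprS valM adde_ge0.
have [z zE] : {z : nat -> R & forall n, iota (z n) = iota g * (c * x ^+ n)}.
  apply: (@choice _ _ (fun n r => iota r = iota g * (c * x ^+ n))) => n.
  have [|r _ rE] := gK (c * x ^+ n); last by exists r.
  apply: valge_gamma_sub => i; rewrite valM vc -[leLHS]adde0.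
  exact: leeD.
have [N [d zN]] := noetherian_dependence z (adm_noetherian hR).
have xN : x ^+ N = \sum_(k < N) iota (d k) * x ^+ k.
  apply: (mulrI uc); apply: (mulrI ug); rewrite -zE zN rmorph_sum !mulr_sumr.
  by apply: eq_bigr => k _; rewrite rmorphM zE; ring.
exists ('X^N - \poly_(k < N) d k).
  rewrite monicE lead_coefDl ?lead_coefXn // size_polyN size_polyXn ltnS.
  exact: size_poly.
rewrite rootE rmorphB /= map_polyXn hornerD hornerN hornerXn subr_eq0 xN.
rewrite poly_def rmorph_sum horner_sum; apply/eqP/eq_bigr => k _.
by rewrite /= map_polyZ /= map_polyXn hornerZ hornerXn.
Qed.

Lemma maximal_ideal_val i : maximal_ideal (int_closure iota)
  [set y | int_closure iota y /\ (0 < val i y)%E].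
Proof.
rewrite int_closureE; set O := [set x | _]; set n := [set y | _].
have O1 : O 1 by move=> j; rewrite (dval1 (dv j)).
have OM x y : O x -> O y -> O (x * y).
  by move=> hx hy j; rewrite valM adde_ge0.
have OD x y : O x -> O y -> O (x + y) by move=> hx hy j; exact: (dval_ge_add (dv j)).
split; first split=> //.
- by move=> x [].
- by split; [move=> j|]; rewrite (dval0 (dv _)).
- by move=> x y [Ox vx] [Oy vy]; split; [exact: OD | exact: (dval_gt_add (dv i))].
- by move=> a x Oa [Ox vx]; split; [exact: OM | rewrite valM lte_paddl].
- move=> nO; have : n 1 by rewrite nO.
  by case=> _; rewrite (dval1 (dv i)) ltxx.
move=> J [JO _ JD JM] nJ; have [Jn|] := pselect (J `<=` n).
  by left; apply/seteqP.
move=> /existsNP [y /not_implyP [Jy ny]]; right; apply/seteqP; split=> //.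
have Oy := JO _ Jy.
have vy : ~~ (0 < val i y)%E by apply/negP => vy; apply: ny.
(* [e] has value 1 where [y] has value 0, and value 0 elsewhere. It lies in [n], and [y + e] has all
   values 0, so [J] contains a unit of the integral closure. *)
have [e [ue ve]] := approxf (fun j => ~~ (0 < val j y)%E : nat).
have Je : J e.
  apply: nJ; split; last by rewrite ve vy lte_fin.
  by move=> j; rewrite ve lee_fin.
have vye j : val j (y + e) = 0%:E.
  have [vj|vj] := boolP (0 < val j y)%E.
    by rewrite addrC (dvalD (dv j)) ve vj.
  have vj0 : val j y = 0%E by apply/eqP; rewrite eq_le Oy andbT leNgt.
  by rewrite (dvalD (dv j)) // vj0 ve vj lte_fin.
have uye : y + e \is a GRing.unit := val_unit vye.
move=> x Ox; rewrite -(divrK uye x); apply: JM; last exact: JD.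
by apply: OM => // j; rewrite (valV uye (vye j)) oppr0.
Qed.

Lemma residue_int i y : (forall j, (0 <= val j y)%E) ->
  exists r, (0 < val i (y - iota r))%E.
Proof.
move=> hy; have [|r [_ vr]] := adm_residue hR (maximal_ideal_val i) (x := y).
  by rewrite int_closureE.
by exists r.
Qed.

(* Multiplying by a unit close to 1 at [i] and small at the other valuations
   moves [c] into the integral closure. *)
Lemma residue_val i c : val i c = 0%E -> exists r, (0 < val i (c - iota r))%E.
Proof.
move=> vc.
(* [e] and [e'] never have equal values, and their smaller value is always 0; hence [e + e'] has all
   values 0, and [f = 1 - e' / (e + e')] is close to 1 at [i]. *)
have [e [ue ve]] := approxf (fun j => if j == i then 0 else `|fine (val j c)| + 1).
have [e' [_ ve']] := approxf (fun j => if j == i then 1 else 0).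
have vh j : val j (e + e') = 0%:E.
  have [->|ji] := eqVneq j i; first by rewrite (dvalD (dv i)) ve ?ve' eqxx ?lte_fin.
  rewrite addrC (dvalD (dv j)) ve' (negbTE ji) // ve (negbTE ji) lte_fin.
  by rewrite ltr_wpDl.
have uh := val_unit vh; pose f := e / (e + e').
have [|r vr] := residue_int i (y := c * f).
  move=> j; rewrite !valM ve (valV uh (vh j)) oppr0 adde0.
  have [->|ji] := eqVneq j i; first by rewrite vc adde0.
  have [->|[a ->]] := dvalP (dv j) c; first by rewrite addye // leey.
  by rewrite -EFinD lee_fin /=; lia.
exists r.
have -> : c - iota r = c * (e' / (e + e')) + (c * f - iota r).
  have E : e' / (e + e') + f = 1 by rewrite /f -mulrDl addrC divrr.
  by rewrite addrA -mulrDr E mulr1.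
apply: (dval_gt_add (dv i)) => //.
by rewrite !valM vc ve' eqxx (valV uh (vh i)) oppr0 adde0 add0e lte_fin.
Qed.

Lemma val_cancel i x y : x \is a GRing.unit -> y \is a GRing.unit ->
  val i x = val i y -> exists r, (val i x < val i (x - iota r * y))%E.
Proof.
move=> ux uy xy; have [a [vx _]] := dval_unit (dv i) ux.
have [|r vr] := residue_val (i := i) (c := x / y).
  by rewrite valM (valV (a := a) uy) -?xy // vx -EFinD subrr.
exists r; have -> : x - iota r * y = (x / y - iota r) * y by rewrite mulrBl divrK.
by rewrite valM -xy vx lteDr.
Qed.

(** For [y] in the integral closure choose [r] in [R] congruent to [y] at [i]. Then
    [x y = r x + (y - r) x], and the last term gains the missing unit of value at [i]; so [x] is in
    the conductor. *)
Lemma conductor_edge i x : K0 x -> ((gamma ord0 i - 1)%:E <= val i x)%E ->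
  (forall j, j != i -> ((gamma ord0 j)%:E <= val j x)%E) ->
  ((gamma ord0 i)%:E <= val i x)%E.
Proof.
move=> Kx vi vj; case: hgamma => _ E.
suff : colon K0 (int_closure iota) x by rewrite E; apply.
rewrite int_closureE => y vy; have [r vr] := residue_int i vy.
have -> : x * y = iota r * x + (y - iota r) * x by ring.
have [_ KD KM] := submodK0; apply: KD; first exact: KM.
apply: valge_gamma_sub => j; rewrite valM.
have [->|ji] := eqVneq j i; last first.
  rewrite -[leLHS]add0e leeD ?vj //; apply: (dval_ge_add (dv j)) => //.
  by rewrite (dvalN (dv j)) val_iota.
have [->|[a vxa]] := dvalP (dv i) x; first by rewrite addey ?leey // dval_Nninfty.
have [->|[b vyb]] := dvalP (dv i) (y - iota r); first by rewrite addye ?leey // dval_Nninfty.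
move: vi vr; rewrite vxa vyb -EFinD !lee_fin lte_fin; lia.
Qed.

(** * Duality and the ideals [valge a] *)

Lemma colon_valge (a : 'rV[int]_p) : colon K0 (valge a) = valge (gamma - a).
Proof.
(* [valge a] is [c] times the integral closure, so its dual is the conductor divided by [c]. *)
have [c [uc vc]] := approx a; case: hgamma => _ E.
apply/seteqP; split=> x hx; last first.
  move=> y hy; apply: valge_gamma_sub => i.
  by rewrite valM -[gamma](subrK a) !mxE EFinD leeD //; have := hx i; rewrite !mxE.
have : colon K0 (int_closure iota) (x * c).
  rewrite int_closureE => y vy; rewrite -mulrA; apply: hx => i.
  by rewrite valM vc -[leLHS]adde0 leeD.
rewrite E => h i; move: (h i); rewrite valM vc !mxE.
by rewrite EFinB leeBlDr.
Qed.

Lemma valge_bounded a : exists g, GRing.lreg g /\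
  forall x, valge a x -> range iota (iota g * x).
Proof.
have [c [uc vc]] := approx (gamma - a).
have [_ reg frac] := hQ; case: hK0 => -[[_ _ [g [lg gK]]] _] _ _.
have [b [s [ls cE]]] := frac c; have us := reg _ ls.
have bE : iota b = c * iota s by rewrite cE divrK.
exists (g * b); split.
  apply: (lregM lg) => y z yz; have [inj _ _] := hQ; apply: inj.
  have ub : iota b \is a GRing.unit by rewrite bE unitrM uc.
  by apply: (mulrI ub); rewrite -!rmorphM yz.
move=> x hx; have [|r _ rE] := gK (c * x).
  apply: valge_gamma_sub => i.
  by rewrite valM vc -[gamma in leLHS](subrK a) !mxE EFinD leeD // !mxE.
by exists (s * r) => //; rewrite !rmorphM bE rE; ring.
Qed.

Definition sumset (I J : set Q) : set Q := [set x + y | x in I & y in J].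

(** This allows biduality to be applied to the sums in [dual_jump]. *)
Lemma fractional_sumset_valge I a :
  fractional_ideal iota I -> fractional_ideal iota (sumset I (valge a)).
Proof.
move=> [[I0 ID IM] [k [Ik lk]] [g [lg gI]]].
have [V0 VD VM] := valge_submodule a; have [h [lh hV]] := valge_bounded a.
split.
- split.
  + by exists 0 => //; exists 0 => //; rewrite addr0.
  + move=> _ _ [x Ix [y Vy <-]] [x' Ix' [y' Vy' <-]].
    by exists (x + x'); [exact: ID | exists (y + y'); [exact: VD | rewrite addrACA]].
  + move=> r _ [x Ix [y Vy <-]].
    by exists (iota r * x); [exact: IM | exists (iota r * y); [exact: VM | rewrite mulrDr]].
- by exists k; split=> //; exists k => //; exists 0 => //; rewrite addr0.
- exists (g * h); split; first exact: lregM.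
  move=> _ [x Ix [y Vy <-]]; have [[b _ bE] [d _ dE]] := (gI x Ix, hV y Vy).
  by exists (h * b + g * d) => //; rewrite rmorphD !rmorphM bE dE; ring.
Qed.

Lemma colon_sumset I J : I 0 -> J 0 ->
  colon K0 (sumset I J) = colon K0 I `&` colon K0 J.
Proof.
move=> I0 J0; apply/seteqP; split=> x.
  move=> h; split=> y hy; apply: h.
    by exists y => //; exists 0 => //; rewrite addr0.
  by exists 0 => //; exists y => //; rewrite add0r.
move=> [hI hJ] _ [y Iy [z Jz <-]]; rewrite mulrDr.
by have [_ KD _] := submodK0; apply: KD; [exact: hI | exact: hJ].
Qed.

(* With I' the dual of I, D(b) = valge b and b = gamma - v - e_i, the duals of
   I' + D(b) and I' + D(b + e_i) consist of the elements of I with values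
   >= v + e_i and >= v.  If these coincide, so do the double duals. *)
Lemma dual_jump (I : set Q) i (v : 'rV[int]_p) : fractional_ideal iota I ->
  (forall x, I x -> valge v x -> ((v ord0 i)%:E < val i x)%E) ->
  exists y, [/\ colon K0 I y, val i y = (gamma ord0 i - v ord0 i - 1)%:E &
    forall j, j != i -> ((gamma ord0 j - v ord0 j)%:E <= val j y)%E].
Proof.
move=> fI hI; have [[fK dual] _ _] := hK0.
have fIv := fractional_colon hQ fK fI.
pose b := gamma - v - delta_mx ord0 i; pose b' := gamma - v.
have bE j : b ord0 j = gamma ord0 j - v ord0 j - (j == i)%:R.
  by rewrite !mxE eqxx.
have b'E j : b' ord0 j = gamma ord0 j - v ord0 j by rewrite !mxE.
have [c [uc vc]] := approx b.
have V0 a : valge a 0 by case: (valge_submodule a).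
have Iv0 : colon K0 I 0 by case: fIv => -[].
have dualE a : colon K0 (sumset (colon K0 I) (valge a)) = I `&` valge (gamma - a).
  by rewrite colon_sumset // colon_valge dual.
have eqd : colon K0 (sumset (colon K0 I) (valge b)) =
           colon K0 (sumset (colon K0 I) (valge b')).
  rewrite !dualE; apply/seteqP; split=> x [Ix vx]; split=> // j; move: (vx j).
    by apply: le_trans; rewrite lee_fin !mxE; lia.
  have : ((v ord0 i)%:E < val i x)%E.
    apply: hI => // l; move: (vx l); rewrite !mxE; apply: le_trans.
    by rewrite lee_fin subKr.
  move=> vi vj; rewrite !mxE eqxx /=.
  have [->|ji] := eqVneq j i.
    have [->|[k vk]] := dvalP (dv i) x; first by rewrite leey.
    by move: vi; rewrite vk lte_fin lee_fin; lia.
  apply: le_trans vj; rewrite lee_fin !mxE.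
  by move: (gamma ord0 j) (v ord0 j) => ? ?; lia.
(* [c] lies in [valge b], hence in the sum with [valge b']. Subtracting its [valge b'] component
   leaves an element of the dual whose value at [i] is still [b_i]. *)
have : sumset (colon K0 I) (valge b') c.
  have fS a := fractional_sumset_valge a fIv.
  rewrite -(dual _ (fS b')) -eqd (dual _ (fS b)).
  by exists 0 => //; exists c; rewrite ?add0r // => j; rewrite vc.
case=> y Iy [z vz yz]; exists y; have -> : y = c - z by rewrite -yz addrK.
split; first by rewrite -yz addrK.
  rewrite (dvalD (dv i)); first by rewrite vc bE eqxx.
  rewrite (dvalN (dv i)); apply: lt_le_trans (vz i).
  by rewrite vc lte_fin bE b'E eqxx; lia.
move=> j ji; apply: (dval_ge_add (dv j)).
  by rewrite vc lee_fin bE (negbTE ji); lia.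
by rewrite (dvalN (dv j)); apply: le_trans (vz j); rewrite lee_fin b'E.
Qed.

(** The cardinality condition on the residue field supplies one residue class for each of the [p]
    valuation rings. *)
Lemma local_classes : exists c : 'I_p -> R, forall i j, m (c i - c j) -> i = j.
Proof.
have [_ [h injV _]] := hval.
have [f] := pcard_leP (adm_card hR).
have finj X Y : dvrs iota X -> dvrs iota Y -> f X = f Y -> X = Y.
  by move=> dX dY; apply: inj; rewrite inE.
pose V i := valuation_ring (val i).
have dV i : dvrs iota (V i) by apply: h.
have [c cE] : {c : 'I_p -> R & forall i, f (V i) = [set y | m (y - c i)]}.
  apply: (@choice _ _ (fun i r => f (V i) = [set y | m (y - r)])) => i.
  have : cosets m (f (V i)) by apply: funS; exact: dV.
  by case=> r _ <-; exists r.
have [[_ _ mD mM] _] := local_proper.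
exists c => i j mij; apply: injV; rewrite ?in_setT //.
apply: (finj _ _ (dV i) (dV j)); rewrite !cE; apply/seteqP; split=> y /= my.
  have -> : y - c j = (y - c i) + (c i - c j) by ring.
  exact: mD.
have -> : y - c i = (y - c j) + (- 1) * (c i - c j) by ring.
by apply: mD => //; exact: mM.
Qed.

(* Given x with the right values at the first k < p valuations and y with the
   right value at the next one, each of the first k valuations spoils
   y + c x for at most one of p pairwise incongruent c. *)
Lemma general_position I (v : 'rV[int]_p) : submodule iota I ->
  (forall i, exists x, [/\ I x, valge v x & val i x = (v ord0 i)%:E]) ->
  exists x, I x /\ forall i, val i x = (v ord0 i)%:E.
Proof.
move=> [_ ID IM] hI; have [c cinj] := local_classes.
have [_ VD VM] := valge_submodule v.
suff ind k : (k <= p)%N -> exists x, [/\ I x, valge v x &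
    forall i, (i < k)%N -> val i x = (v ord0 i)%:E].
  by have [x [Ix _ vx]] := ind _ (leqnn p); exists x; split=> // i; exact: vx.
elim: k => [|k IHk] kp.
  by have [x [Ix Vx _]] := hI (Ordinal p_gt0); exists x.
have [x [Ix Vx vx]] := IHk (ltnW kp).
pose o := Ordinal kp; have [y [Iy Vy vy]] := hI o.
have ltk i : (i < k.+1)%N -> i = o \/ (i < k)%N.
  by rewrite ltnS leq_eqVlt => /orP[/eqP ik|]; [left; exact: val_inj | right].
have [vox|] := boolP (val o x == (v ord0 o)%:E).
  by exists x; split=> // i /ltk[->|/vx //]; exact/eqP.
move=> vox; have {vox} vo : ((v ord0 o)%:E < val o x)%E.
  by rewrite lt_neqAle eq_sym vox Vx.
pose z (t : 'I_p) := y + iota (c t) * x.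
have Vz t : valge v (z t) by apply: VD => //; exact: VM.
have [t zt] : exists t, forall i, (i < k)%N -> val i (z t) = (v ord0 i)%:E.
  apply: contrapT => nz.
  have [f fP] : {f : 'I_p -> 'I_p & forall t,
      (f t < k)%N /\ ((v ord0 (f t))%:E < val (f t) (z t))%E}.
    apply: (@choice _ _ (fun t i => (i < k)%N /\ ((v ord0 i)%:E < val i (z t))%E)) => t.
    apply: contrapT => nt; apply: nz; exists t => i ik; apply/eqP.
    rewrite eq_le Vz andbT leNgt; apply/negP => vz; apply: nt.
    by exists i.
  have finj : injective f.
    (* If one valuation spoils both [z t] and [z u], it exceeds [v] on [(c t - c u) x] but equals
       [v] on [x], so [c t - c u] is in [m]. The pigeonhole principle then contradicts [k < p]. *)
    move=> t u ftu; apply: cinj; apply: (@val_gt0_local (f t)).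
    have [fk vt] := fP t; have [_ vu] := fP u; rewrite -ftu in vu.
    have : ((v ord0 (f t))%:E < val (f t) (z t - z u)%R)%E.
      by apply: (dval_gt_add (dv _)) => //; rewrite dvalN.
    have -> : z t - z u = iota (c t - c u) * x by rewrite /z rmorphB; ring.
    by rewrite valM (vx _ fk) lteDr.
  pose f' t := Ordinal (fP t).1.
  have : injective f' by move=> t u /(congr1 (@nat_of_ord _)) /= /val_inj /finj.
  by move=> /leq_card; rewrite !card_ord leqNgt kp.
exists (z t); split=> //; first by apply: ID => //; exact: IM.
move=> i /ltk[->|/zt //]; rewrite (dvalD (dv o)) vy // valM.
by apply: lt_le_trans vo _; rewrite -[leLHS]add0e leeD // val_iota.
Qed.

(** * Values of an ideal against values of its dual *)

Lemma value_setP E a : value_set val E a <->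
  exists x, E x /\ forall i, val i x = (a ord0 i)%:E.
Proof.
split=> [[x [Ex _ vx]]|[x [Ex vx]]]; exists x => //.
by split=> //; apply: unit_lreg; exact: val_unit vx.
Qed.

(** The product of the two elements lies in [K0] with [i]-th value [gamma_i - 1], so
    [conductor_edge] excludes that all its other values reach [gamma]. *)
Lemma value_set_dual_edge I i a b : value_set val I a ->
  value_set val (colon K0 I) b -> a ord0 i + b ord0 i = gamma ord0 i - 1 ->
  exists2 j, j != i & a ord0 j + b ord0 j < gamma ord0 j.
Proof.
move=> /value_setP[x [Ix vx]] /value_setP[y [hy vy]] abi.
apply: contrapT => nj; have := @conductor_edge i (y * x) (hy x Ix).
rewrite !valM vx vy -EFinD [b _ _ + _]addrC abi !lee_fin lexx => /(_ isT).
suff h : forall j, j != i -> ((gamma ord0 j)%:E <= val j (y * x)%R)%E.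
  by move=> /(_ h); lia.
move=> j ji; rewrite valM vx vy -EFinD addrC lee_fin leNgt.
by apply/negP => lt; apply: nj; exists j.
Qed.

(** If no index had such a [y], then by [dual_jump] each [v_i] would be attained on the part of [I]
    above [v], and [general_position] would attain all of them at once. *)
Lemma value_set_dual I v : fractional_ideal iota I -> ~ value_set val I v ->
  exists i y, [/\ colon K0 I y, val i y = (gamma ord0 i - v ord0 i - 1)%:E &
    forall j, j != i -> ((gamma ord0 j - v ord0 j)%:E <= val j y)%E].
Proof.
move=> fI nv; apply: contrapT => ny; apply: nv; apply/value_setP.
apply: general_position; first exact: fractional_submodule.
move=> i; apply: contrapT => nx; apply: ny; exists i.
apply: dual_jump => // x Ix Vx; rewrite lt_neqAle Vx andbT; apply/eqP => vx.
by apply: nx; exists x.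
Qed.

(** * Exchange property of value sets containing a translate of N^p *)

Section LargeValues.
Variables (E : set Q) (nu : 'rV[int]_p).
Hypothesis sE : submodule iota E.
Hypothesis hnu : forall a, le_vec nu a -> value_set val E a.

(* Adding an element with large values in [E] makes the infinite values of
   [x] finite without changing the finite ones. *)
Lemma value_set_perturb x (B : 'I_p -> int) : E x ->
  exists2 a, value_set val E a &
    forall i, val i x = (a ord0 i)%:E \/ val i x = +oo%E /\ B i < a ord0 i.
Proof.
move=> Ex; pose M i := `|nu ord0 i| + `|B i| + `|fine (val i x)| + 1.
have [|y [Ey _ vy]] := hnu (a := \row_i M i).
  by move=> i; rewrite mxE /M; lia.
have vM i : val i y = (M i)%:E by rewrite vy mxE.
have xy i : val i x = +oo%E /\ val i (x + y) = (M i)%:E \/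
            val i x = (fine (val i x))%:E /\ val i (x + y) = val i x.
  have [vx|[k vx]] := dvalP (dv i) x; [left|right]; split=> //.
  - by rewrite addrC (dvalD (dv i)) vM // vx ltry.
  - by rewrite vx.
  - by rewrite (dvalD (dv i)) // vM vx lte_fin /M vx /=; lia.
exists (\row_i (if val i x == +oo%E then M i else fine (val i x))).
  apply/value_setP; exists (x + y); split; first by case: sE => _ + _; apply.
  by move=> i; rewrite mxE; have [[-> ->]|[xE ->]] := xy i; rewrite ?eqxx // xE.
move=> i; rewrite mxE; have [[-> _]|[xE _]] := xy i.
  by right; rewrite eqxx /M; split=> //; lia.
by left; rewrite xE.
Qed.

(** Subtracting a suitable multiple [r y] from [x] cancels the leading parts at [j], and leaves the
    value at [i] intact because [y] is larger there. *)
Lemma value_set_improve a b i j : value_set val E a -> value_set val E b ->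
  a ord0 j = b ord0 j -> a ord0 i < b ord0 i ->
  exists c, [/\ value_set val E c, c ord0 i = a ord0 i, a ord0 j < c ord0 j &
    forall l, Order.min (a ord0 l) (b ord0 l) <= c ord0 l].
Proof.
move=> /value_setP[x [Ex vx]] /value_setP[y [Ey vy]] abj abi.
have [|r vr] := val_cancel (i := j) (val_unit vx) (val_unit vy).
  by rewrite vx vy abj.
rewrite vx in vr; pose z := x - iota r * y.
have vry l : (val l y <= val l (- (iota r * y))%R)%E.
  by rewrite (dvalN (dv l)) valM -[leLHS]add0e leeD // val_iota.
have Ez : E z.
  case: sE => _ ED EM; rewrite /z -mulNr -rmorphN; apply: ED => //; exact: EM.
have [c Ec cz] := value_set_perturb (fun l => a ord0 l) Ez.
have vzi : val i z = (a ord0 i)%:E.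
  by rewrite (dvalD (dv i)) vx //; apply: lt_le_trans (vry i); rewrite vy lte_fin.
exists c; split=> //.
- by have [|[]] := cz i; rewrite vzi // => -[].
- by have [vz|[]//] := cz j; move: vr; rewrite -/z vz lte_fin.
- move=> l; have [vz|[_ al]] := cz l; last by rewrite ge_min ltW.
  rewrite -lee_fin -vz; apply: (dval_ge_add (dv l)).
    by rewrite vx lee_fin ge_min lexx.
  by apply: le_trans (vry l); rewrite vy lee_fin ge_min lexx orbT.
Qed.

End LargeValues.

End ValueMap.

(** * Combinatorics of absolute maximals in Z^p *)

Section AbsoluteMaximals.
Variable p : nat.
Implicit Types (a b u w : 'rV[int]_p) (S E : set 'rV[int]_p).

Definition weight u : int := \sum_l u ord0 l.

Lemma weightD u w : weight (u + w) = weight u + weight w.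
Proof. by rewrite /weight -big_split; apply: eq_bigr => l _; rewrite mxE. Qed.

Lemma weight_ge0 u : le_vec 0 u -> 0 <= weight u.
Proof. by move=> u0; apply: sumr_ge0 => l _; have := u0 l; rewrite mxE. Qed.

Lemma weight_gt0 u : le_vec 0 u -> u != 0 -> 0 < weight u.
Proof.
move=> u0 un0; rewrite lt_neqAle weight_ge0 // andbT eq_sym.
apply: contra un0 => /eqP wu; apply/eqP/rowP => l; rewrite mxE.
have ul k : true -> 0 <= u ord0 k by have := u0 k; rewrite mxE.
exact: (psumr_eq0P ul wu).
Qed.

Lemma exists_maximal (X : set 'rV[int]_p) u B :
  X u -> (forall w, X w -> le_vec w B) ->
  exists2 w, X w & forall w', X w' -> le_vec w w' -> w' = w.
Proof.
move=> Xu XB.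
have [n] : exists n : nat, weight (B - u) < n.
  by exists `|weight (B - u)|%N.+1; lia.
elim: n u Xu => [|n IHn] u Xu dn.
  suff : 0 <= weight (B - u) by lia.
  by apply: weight_ge0 => l; have := XB _ Xu l; rewrite !mxE subr_ge0.
have [[w [Xw uw wu]]|nw] := pselect (exists w, [/\ X w, le_vec u w & w != u]).
  apply: (IHn w Xw); have : 0 < weight (w - u).
    apply: weight_gt0; last by rewrite subr_eq0.
    by move=> l; rewrite !mxE subr_ge0.
  have : weight (B - u) = weight (B - w) + weight (w - u).
    by rewrite -weightD addrA subrK.
  lia.
exists u => // w Xw uw; apply/eqP/negPn/negP => wu; apply: nw.
by exists w.
Qed.

(** Translation by [a] carries [DeltaJ J b E] into [DeltaJ J (a + b) E]. *)
Lemma absolute_maximal_addl S E a b :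
  (forall x y, S x -> E y -> E (x + y)) -> S a -> E b ->
  absolute_maximal E (a + b) -> absolute_maximal E b.
Proof.
move=> SE Sa Eb [_ ab]; split=> // J J0 JT; apply: contrapT => /eqP/set0P[w [Ew wJ wnJ]].
suff : DeltaJ J (a + b) E (a + w) by rewrite ab.
split; first exact: SE.
  by move=> j jJ; rewrite !mxE wJ.
by move=> j jJ; rewrite !mxE ltrD2l wnJ.
Qed.

Lemma absolute_maximal_addr S E a b :
  (forall x y, S x -> E y -> E (x + y)) -> S a -> E b ->
  absolute_maximal E (a + b) -> absolute_maximal S a.
Proof.
move=> SE Sa Eb [_ ab]; split=> // J J0 JT; apply: contrapT => /eqP/set0P[w [Sw wJ wnJ]].
suff : DeltaJ J (a + b) E (w + b) by rewrite ab.
split; first exact: SE.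
  by move=> j jJ; rewrite !mxE wJ.
by move=> j jJ; rewrite !mxE ltrD2r wnJ.
Qed.

Section Decomposition.
Variables (S E : set 'rV[int]_p) (L : 'rV[int]_p).
Hypothesis S_ge0 : forall a, S a -> le_vec 0 a.
Hypothesis SS : forall a b, S a -> S b -> S (a + b).
Hypothesis SE : forall a b, S a -> E b -> E (a + b).
Hypothesis E_ge : forall b, E b -> le_vec L b.
Variables (q : nat) (g : 'I_q -> 'rV[int]_p).
Hypothesis hg : range g = [set a | irr_abs_max_ring S a].

(** Induction on the weight: both summands of a reducible absolute maximal are absolute maximals of
    smaller weight. Zero is the empty sum. *)
Lemma absolute_maximal_semigroup a : absolute_maximal S a ->
  exists lambda : 'I_q -> nat, a = \sum_(j < q) g j *+ lambda j.
Proof.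
have [n] : exists n : nat, weight a < n by exists `|weight a|%N.+1; lia.
elim: n a => [|n IHn] a an am.
  by have := weight_ge0 (S_ge0 am.1); lia.
have [->|a0] := eqVneq a 0; first by exists (fun=> 0%N); rewrite big1.
have [[b [c [[Sb b0] [Sc c0] abc]]]|irr] := pselect
    (exists b c, [/\ S b /\ b != 0, S c /\ c != 0 & a = b + c]).
  have wb := weight_gt0 (S_ge0 Sb) b0; have wc := weight_gt0 (S_ge0 Sc) c0.
  rewrite abc weightD in an; rewrite abc in am *.
  have [|x ->] := IHn b _ (absolute_maximal_addr SS Sb Sc am); first lia.
  have [|y ->] := IHn c _ (absolute_maximal_addl SS Sb Sc am); first lia.
  exists (fun j => (x j + y j)%N).
  by rewrite -big_split; apply: eq_bigr => j _; rewrite mulrnDr.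
have : range g a by rewrite hg.
case=> j _ <-; exists (fun k => (k == j) : nat).
rewrite (bigD1 j) //= eqxx big1 ?addr0 // => k /negbTE->.
by rewrite mulr0n.
Qed.

(** Splitting off a nonzero element of [S] lowers the weight of [b - L], which stays nonnegative;
    the part split off is an absolute maximal of [S]. *)
Lemma absolute_maximal_module s (beta : 'I_s -> 'rV[int]_p) b :
  range beta = [set b | irr_abs_max S E b] -> absolute_maximal E b ->
  exists i (lambda : 'I_q -> nat), b = \sum_(j < q) g j *+ lambda j + beta i.
Proof.
move=> hbeta.
have [n] : exists n : nat, weight (b - L) < n.
  by exists `|weight (b - L)|%N.+1; lia.
elim: n b => [|n IHn] b bn bm.
  have : 0 <= weight (b - L); last lia.
  by apply: weight_ge0 => l; rewrite !mxE subr_ge0; exact: E_ge bm.1 l.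
have [[a [c [Sa a0 Ec bac]]]|irr] := pselect
    (exists a c, [/\ S a, a != 0, E c & b = a + c]).
  have wa := weight_gt0 (S_ge0 Sa) a0.
  rewrite bac -addrA weightD in bn; rewrite bac in bm *.
  have [x ->] := absolute_maximal_semigroup (absolute_maximal_addr SE Sa Ec bm).
  have [|i [y ->]] := IHn c _ (absolute_maximal_addl SE Sa Ec bm).
    by rewrite -(ltrD2l (weight a)); apply: lt_le_trans bn _; lia.
  exists i, (fun j => (x j + y j)%N); rewrite addrA -big_split.
  by congr (_ + _); apply: eq_bigr => j _; rewrite mulrnDr.
have : range beta b by rewrite hbeta.
case=> i _ <-; exists i, (fun=> 0%N).
by rewrite big1 ?add0r // => j _; rewrite mulr0n.
Qed.

End Decomposition.

(** A maximal element [w] of the bounded set works. A point [w'] of some [DeltaJ J w E] contradicts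
    maximality directly if [i] is in [J]; otherwise the exchange property, applied at some [j] in
    [J], restores the [i]-th entry of [w] and raises the [j]-th. *)
Lemma Delta_absolute_maximal E alpha i u B :
  (forall a b k j, E a -> E b -> a ord0 j = b ord0 j -> a ord0 k < b ord0 k ->
    exists c, [/\ E c, c ord0 k = a ord0 k, a ord0 j < c ord0 j &
      forall l, Order.min (a ord0 l) (b ord0 l) <= c ord0 l]) ->
  DeltaJ (finset.set1 i) alpha E u ->
  (forall w, DeltaJ (finset.set1 i) alpha E w -> le_vec w B) ->
  exists2 w, DeltaJ (finset.set1 i) alpha E w & absolute_maximal E w.
Proof.
move=> improve Du DB; have [w Dw wmax] := exists_maximal Du DB; exists w => //.
have up w' : E w' -> le_vec w w' -> w' ord0 i = w ord0 i -> w' = w.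
  move=> Ew' ww' wi; apply: wmax => //; case: Dw => Ew Di Dni; split=> // j jD.
    by have := Di j jD; move: jD; rewrite finset.inE => /eqP ->; rewrite wi.
  exact: lt_le_trans (Dni j jD) (ww' j).
have Ew : E w by case: Dw.
split=> // J /finset.set0Pn[j jJ] JT; apply: contrapT => /eqP/set0P[w' [Ew' wJ wnJ]].
have ww' : le_vec w w'.
  by move=> l; have [/wJ->//|/wnJ/ltW] := boolP (l \in J).
have [iJ|niJ] := boolP (i \in J).
  have [l lJ] : exists l, l \notin J.
    apply: contrapT => nl; case/negP: JT; apply/eqP/setP => l; rewrite finset.inE.
    by apply/negPn/negP => lJ; apply: nl; exists l.
  by have := wnJ l lJ; rewrite (up w') ?ltxx // wJ.
have [c [Ec ci cj cl]] := improve w w' i j Ew Ew' (esym (wJ j jJ)) (wnJ i niJ).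
have wc : le_vec w c.
  move=> l; apply: le_trans (cl l); rewrite le_min lexx /=; exact: ww'.
by move: cj; rewrite (up c) ?ltxx.
Qed.

(** If [w_k >= nu_k], raising all other entries of [w] far enough gives a point of [E] in [DeltaJ]
    for the set {k}, which is a proper subset as [p >= 2]. *)
Lemma absolute_maximal_lt E nu w : (2 <= p)%N ->
  (forall a, le_vec nu a -> E a) -> absolute_maximal E w ->
  le_vec w (nu - const_mx 1).
Proof.
move=> p2 hnu [Ew wmax] k; rewrite !mxE leNgt; apply/negP => wk.
pose u := \row_l (if l == k then w ord0 l else `|nu ord0 l| + `|w ord0 l| + 1).
have J0 : finset.set1 k != finset.set0 by apply/finset.set0Pn; exists k; rewrite finset.inE.
have JT : finset.set1 k != finset.setTfor 'I_p.
  apply/eqP => /(congr1 (fun A : {set 'I_p} => #|A|)).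
  by rewrite cards1 cardsT card_ord; lia.
suff : DeltaJ (finset.set1 k) w E u by rewrite (wmax _ J0 JT).
split.
- apply: hnu => l; rewrite mxE; case: eqP => [->|_]; last lia.
  by move: wk; rewrite ltrBlDr ltzD1.
- by move=> j; rewrite finset.inE mxE => ->.
- by move=> j; rewrite finset.inE mxE => /negbTE->; lia.
Qed.

End AbsoluteMaximals.

Theorem proposition4p6
  (R : comNzRingType) (Q : comUnitRingType) (iota : {rmorphism R -> Q})
  (m : set R)
  (hQ : total_ring_of_fractions iota)
  (hR : admissible iota m)
  (p : nat) (hp : (2 <= p)%N)
  (val : 'I_p -> Q -> \bar int) (hval : value_map iota val)
  (K0 : set Q) (hK0 : normalized_canonical_ideal iota K0)
  (gamma : 'rV[int]_p) (hgamma : conductor iota val K0 gamma)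
  (I : set Q) (hI : fractional_ideal iota I)
  (q : nat) (g : 'I_q -> 'rV[int]_p)
  (hg : range g = [set a | irr_abs_max_ring (value_set val (range iota)) a])
  (s : nat) (beta : 'I_s -> 'rV[int]_p)
  (hbeta : range beta =
     [set b | irr_abs_max (value_set val (range iota))
                          (value_set val (colon K0 I)) b])
  (nu : 'rV[int]_p)
  (hnu : forall a, le_vec nu a -> value_set val (colon K0 I) a)
  (v : 'rV[int]_p)
  (hv : forall J : {set 'I_p}, #|J| = p.-1 ->
     (pr J @` value_set val I) (pr J v)) :
  value_set val I v <->
  (forall w, setF' gamma (setF g beta nu) w -> ~ Delta w [set: 'rV[int]_p] v).
Proof.
have p0 : (0 < p)%N by apply: ltnW.
have shiftE (a : 'rV[int]_p) l :
    (gamma - a - const_mx 1) ord0 l = gamma ord0 l - a ord0 l - 1.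
  by rewrite !mxE.
have apx := approx_of_cofinal hQ hval hnu.
set ER := value_set val (range iota) in hg hbeta *.
set E := value_set val (colon K0 I) in hbeta hnu.
have sE : submodule iota (colon K0 I).
  by apply: submodule_colon; apply: fractional_submodule; case: hK0 => -[].
have ER_ge0 a : ER a -> le_vec 0 a.
  move=> [_ [[r _ <-] _ vr]] i; rewrite mxE -lee_fin -vr.
  exact: val_iota hval i r.
have ERR a b : ER a -> ER b -> ER (a + b).
  apply: (value_setD hval) => _ _ [r _ <-] [t _ <-].
  by exists (r * t) => //; rewrite rmorphM.
have ERE a b : ER a -> E b -> E (a + b).
  apply: (value_setD hval) => _ y [r _ <-] hy.
  by case: sE => _ _; apply.
have edge := value_set_dual_edge hQ hR hval hK0 hgamma p0 apx.
split=> [Iv w [u [i [lambda [uE _]]] <-] [k _ [_ wk wnk]]|hF].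
  (* The value set of the dual is stable under adding values of [R], so it contains [setF]. *)
  have Eu : E u.
    rewrite uE; have Eb : E (beta i).
      have : range beta (beta i) by exists i.
      by rewrite hbeta => -[[]].
    elim: (index_enum _) => [|j r IHr]; first by rewrite big_nil add0r.
    rewrite big_cons -addrA; elim: (lambda j) => [|n IHn]; first by rewrite mulr0n add0r.
    rewrite mulrS -addrA; apply: ERE => //.
    have : range g (g j) by exists j.
    by rewrite hg => -[_ []].
  (* Here [v_k + u_k = gamma_k - 1] and [v_j + u_j >= gamma_j] for the other [j], which [edge]
     forbids. *)
  have vk := wk k (finset.set11 k); rewrite shiftE in vk.
  have [|j jk] := edge I k v u Iv Eu; first lia.
  have := wnk j; rewrite finset.inE => /(_ jk); rewrite shiftE; lia.
apply: contrapT => nv.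
have [i [y [hy yi yni]]] := value_set_dual hQ hR hval hK0 hgamma p0 apx hI nv.
pose alpha := gamma - v - const_mx 1.
have alphaE l : alpha ord0 l = gamma ord0 l - v ord0 l - 1 := shiftE v l.
(* [y] may have infinite values away from [i]; they are replaced by finite ones above [alpha]. *)
have [u Eu yu] := value_set_perturb hQ hR hval hK0 hgamma p0 sE hnu
  (fun l => alpha ord0 l) hy.
have Du : DeltaJ (finset.set1 i) alpha E u.
  split=> // j; rewrite finset.inE.
    by move=> /eqP->; have := yu i; rewrite yi alphaE; case=> [[->]|[]].
  move=> ji; have [yj|[]//] := yu j; move: (yni j ji); rewrite yj lee_fin alphaE; lia.
have [B DB] : exists B, forall w, DeltaJ (finset.set1 i) alpha E w -> le_vec w B.
  have [B hB] : {B : 'I_p -> int & forall k w,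
      DeltaJ (finset.set1 i) alpha E w -> w ord0 k <= B k}.
    apply: (@choice _ _ (fun k b => forall w, DeltaJ (finset.set1 i) alpha E w ->
      w ord0 k <= b)) => k.
    have [<-|ik] := eqVneq i k.
      by exists (alpha ord0 i) => w [_ /(_ i)]; rewrite finset.set11 => ->.
    (* [v'] is a value of [I] agreeing with [v] off [k]. For [w] in the set, [edge] at [i] yields
       some [j] with [v'_j + w_j < gamma_j]; since [w_j > alpha_j], this [j] can only be [k], which
       bounds [w_k]. *)
    have [|v' Iv' prv] := hv (~: finset.set1 k)%SET.
      by rewrite cardsC1 card_ord.
    have v'E l : l != k -> v' ord0 l = v ord0 l.
      move=> lk; have lJ : l \in (~: finset.set1 k)%SET by rewrite !finset.inE.
      have := congr1 (fun x : 'rV[int]_#|_| => x ord0 (enum_rank_in lJ l)) prv.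
      by rewrite !mxE enum_rankK_in.
    exists (gamma ord0 k - v' ord0 k - 1) => w [Ew wi wni].
    have wiE : w ord0 i = alpha ord0 i by apply: wi; rewrite finset.set11.
    have [|j ji] := edge I i v' w Iv' Ew.
      by rewrite wiE alphaE (v'E _ ik); lia.
    have [->|jk] := eqVneq j k; first lia.
    have := wni j; rewrite finset.inE => /(_ ji).
    by rewrite alphaE (v'E _ jk); lia.
  by exists (\row_k B k) => w Dw k; rewrite mxE; exact: hB.
have [|w Dw wmax] := Delta_absolute_maximal _ Du DB.
  move=> a b k j Ea Eb.
  exact: (value_set_improve hQ hR hval hK0 hgamma p0 apx sE hnu Ea Eb).
have fK : fractional_ideal iota K0 by case: hK0 => -[].
have [L EL] := value_set_lower_bound hQ hval (fractional_colon hQ fK hI).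
have [j [lambda wE]] := absolute_maximal_module ER_ge0 ERR ERE EL hg hbeta wmax.
(* The reflection is symmetric: [w] in Delta_i(gamma - v - 1) means [v] in Delta_i(gamma - w -
   1). *)
apply: (hF (gamma - w - const_mx 1)).
  exists w => //; exists j, lambda; split=> //.
  exact: absolute_maximal_lt wmax.
case: Dw => Ew wi wni; exists i => //; split=> // k.
  by move=> kJ; have := wi k kJ; rewrite alphaE shiftE; lia.
by move=> kJ; have := wni k kJ; rewrite alphaE shiftE; lia.
Qed.
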